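(* Let $m$ be a positive integer and $q=2^m$. Then the trinomial $F_3(X)=X^{7}\left(X^{7(q-1)}+X^{5(q-1)}+1\right)$ is a permutation polynomial of $\mathbb{F}_{q^2}$ if and only if $m$ is even and $m\not\equiv 0\pmod 3$.
   Context: A polynomial $f\in\mathbb{F}_{q^2}[X]$ is a permutation polynomial of $\mathbb{F}_{q^2}$ if the map $x\mapsto f(x)$ is a bijection of $\mathbb{F}_{q^2}$. *)

(* Defs.v *)
From HB Require Import structures.
From mathcomp Require Import all_boot all_order all_algebra.
Set Implicit Arguments.
Unset Strict Implicit.
Unset Printing Implicit Defensive.
Import GRing.Theory.
Local Open Scope ring_scope.

Definition permutation_poly (F : finFieldType) (f : {poly F}) : Prop :=
  bijective (fun x : F => f.[x]).

Definition F3 (F : finFieldType) (q : nat) : {poly F} :=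
  'X^7 * ('X^(7 * (q - 1)) + 'X^(5 * (q - 1)) + 1).

(* Main.v *)
Require Import Defs.
From HB Require Import structures.
From mathcomp Require Import all_boot all_order all_algebra.
From mathcomp Require Import cyclic finfield ring zify.
Set Implicit Arguments.
Unset Strict Implicit.
Unset Printing Implicit Defensive.
Import GRing.Theory.
Local Open Scope ring_scope.

(** For x != 0 put u = x^(q-1), a (q+1)-st root of unity, so that u^q = 1/u and
    F_3(x) = x^7 h(u) with h(u) = u^7 + u^5 + 1. If h has no root among the
    (q+1)-st roots of unity and F_3(x) = F_3(y), comparing q-th powers gives
    h(u) h*(v) = h(v) h*(u), where h* is the reciprocal polynomial of h. In
    characteristic 2 the difference of the two sides is
    (u^2+u+1)(v^2+v+1)(u-v) A(u,v) A*(u,v) with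
    A(u,v) = 1-u-v-u^2v-uv^2, and A* = u^2 v^2 A(1/u,1/v). Conjugation x |-> x^q
    exchanges the zeros of A and A*, which have no common zero, whence u = v and
    then x = y. The factorization reflects that h*/h is, up to cancelling
    u^2+u+1, the Lattes map of an endomorphism of degree 5 of a supersingular
    elliptic curve. *)

Definition trinomial7 (R : pzRingType) (u : R) : R := u ^+ 7 + u ^+ 5 + 1.
Definition trinomial7_rec (R : pzRingType) (u : R) : R := u ^+ 7 + u ^+ 2 + 1.
Definition isogeny_factor (R : pzRingType) (u v : R) : R :=
  1 - u - v - u ^+ 2 * v - u * v ^+ 2.
Definition isogeny_factor_rec (R : pzRingType) (u v : R) : R :=
  u ^+ 2 * v ^+ 2 - u * v ^+ 2 - u ^+ 2 * v - u - v.

Lemma horner_F3 (F : finFieldType) (q : nat) (x : F) :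
  (F3 F q).[x] = x ^+ 7 * trinomial7 (x ^+ (q - 1)).
Proof.
by rewrite /F3 /trinomial7 !hornerE -!exprM [(7 * _)%N]mulnC [(5 * _)%N]mulnC.
Qed.

Lemma trinomial7_cross (R : comPzRingType) (u v : R) : 2%:R = 0 :> R ->
  trinomial7 u * trinomial7_rec v - trinomial7 v * trinomial7_rec u =
  (u ^+ 2 + u + 1) * (v ^+ 2 + v + 1) *
    ((u - v) * isogeny_factor u v * isogeny_factor_rec u v).
Proof.
move=> two0; apply/eqP; rewrite -subr_eq0; apply/eqP.
(* Over the integers the two sides differ by twice this explicit cofactor, so [ring] needs no
   knowledge of the characteristic. *)
transitivity (2%:R * ((u ^+ 2 + u + 1) * (v ^+ 2 + v + 1) *
  (u ^+ 2 * v ^+ 3 - u ^+ 3 * v ^+ 2 + u * v ^+ 4 - u ^+ 4 * v))).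
  rewrite /trinomial7 /trinomial7_rec /isogeny_factor /isogeny_factor_rec.
  ring.
by rewrite two0 mul0r.
Qed.

(** The difference of the two factors is (uv)^2 - 1 = (uv - 1)^2 in characteristic 2, so a common
    zero has uv = 1; there the first factor equals 1 - 2(u + v) = 1. *)
Lemma isogeny_factors_coprime (R : idomainType) (u v : R) : 2%:R = 0 :> R ->
  isogeny_factor u v = 0 -> isogeny_factor_rec u v != 0.
Proof.
move=> two0 A0; apply/eqP=> B0.
have : (u * v - 1) * (u * v + 1) = 0.
  have -> : (u * v - 1) * (u * v + 1) =
    isogeny_factor_rec u v - isogeny_factor u v.
    rewrite /isogeny_factor /isogeny_factor_rec; ring.
  by rewrite A0 B0 subr0.
have -> : u * v + 1 = u * v - 1 + 2%:R by ring.
rewrite two0 addr0 => /eqP; rewrite mulf_eq0 orbb subr_eq0 => /eqP uv1.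
move: A0; have -> : isogeny_factor u v =
    1 - (u * v - 1) * (u + v) - 2%:R * (u + v) by rewrite /isogeny_factor; ring.
by rewrite uv1 two0 subrr !mul0r !subr0 => /eqP; rewrite oner_eq0.
Qed.

Section QuadraticExtension.

Variables (m q : nat) (F : finFieldType).
Hypotheses (m_gt0 : (0 < m)%N) (q_def : q = (2 ^ m)%N) (cardF : #|F| = (q ^ 2)%N).

Let q_gt1 : (1 < q)%N.
Proof. by rewrite q_def -{1}(expn0 2) ltn_exp2l. Qed.

Let pchar2 : 2 \in [pchar F].
Proof.
by apply: (@card_finPcharP _ _ (m * 2)) => //; rewrite cardF q_def expnM.
Qed.

Let two0 : 2%:R = 0 :> F.
Proof. exact: pcharf0 pchar2. Qed.

Let opp2 (x : F) : - x = x.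
Proof. exact: oppr_pchar2 pchar2 x. Qed.

Let frobD (x y : F) : (x + y) ^+ q = x ^+ q + y ^+ q.
Proof.
apply: exprDn_pchar; rewrite (eq_pnat _ (pcharf_eq pchar2)) q_def pnatX.
by rewrite pnat_id.
Qed.

Let expr_cardB1 (x : F) : x != 0 -> x ^+ ((q - 1) * (q + 1)) = 1.
Proof.
move=> x0; apply: (mulfI x0).
rewrite mulr1 -exprS -[RHS]expf_card cardF; congr (_ ^+ _); nia.
Qed.

Lemma trinomial7_frob (u : F) : u * u ^+ q = 1 ->
  u ^+ 7 * trinomial7 u ^+ q = trinomial7_rec u.
Proof.
rewrite /trinomial7 /trinomial7_rec !frobD expr1n.
rewrite -!exprM [(7 * _)%N]mulnC [(5 * _)%N]mulnC !exprM; set w := u ^+ q => uw.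
transitivity ((u * w) ^+ 7 + u ^+ 2 * (u * w) ^+ 5 + u ^+ 7); first by ring.
by rewrite uw !expr1n; ring.
Qed.

Lemma isogeny_factor_frob (u v : F) : u * u ^+ q = 1 -> v * v ^+ q = 1 ->
  isogeny_factor u v = 0 -> isogeny_factor_rec u v = 0.
Proof.
move=> uU vV A0.
have : isogeny_factor u v ^+ q = 0 by rewrite A0 expr0n; case: (q) q_gt1.
rewrite /isogeny_factor !frobD !opp2 expr1n !expr2 !exprMn.
move: uU vV; set w := u ^+ q; set z := v ^+ q => uw vz E.
(* Inserting uw = 1 and vz = 1 into the monomials turns the claim into a polynomial identity in u,
   v, w, z. *)
transitivity (u ^+ 2 * v ^+ 2 - u * v ^+ 2 * (u * w) - u ^+ 2 * v * (v * z)
  - v * (u * w) ^+ 2 * (v * z) - u * (u * w) * (v * z) ^+ 2).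
  by rewrite uw vz /isogeny_factor_rec; ring.
transitivity (u ^+ 2 * v ^+ 2 * (1 - w - z - w ^+ 2 * z - w * z ^+ 2)).
  by ring.
by rewrite !opp2 !expr2 E mulr0.
Qed.

Lemma trinomial7_ratio_inj (u v : F) : u * u ^+ q = 1 -> v * v ^+ q = 1 ->
  trinomial7 u != 0 -> trinomial7 v != 0 ->
  trinomial7 u * trinomial7_rec v = trinomial7 v * trinomial7_rec u -> u = v.
Proof.
move=> uU vV hu hv /eqP; rewrite -subr_eq0 trinomial7_cross //.
(* Primitive cube roots of unity are roots of h, as 7 and 5 are 1 and 2 modulo 3. *)
have quad_neq0 (t : F) : trinomial7 t != 0 -> t ^+ 2 + t + 1 != 0.
  apply: contraNneq => t0.
  have -> : trinomial7 t =
    (t ^+ 2 + t + 1) * (t ^+ 5 - t ^+ 4 + t ^+ 3 - t + 1).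
    by rewrite /trinomial7; ring.
  by rewrite t0 mul0r.
rewrite !mulf_eq0 (negPf (quad_neq0 _ hu)) (negPf (quad_neq0 _ hv)) /=.
rewrite -orbA => /or3P[|/eqP A0|/eqP B0]; first by rewrite subr_eq0 => /eqP.
- by have := isogeny_factors_coprime two0 A0; rewrite isogeny_factor_frob ?eqxx.
(* A zero of A* reduces to the previous case by passing to the conjugate pair (u^q, v^q). *)
have conj1 (t : F) : t * t ^+ q = 1 -> t ^+ q * t ^+ q ^+ q = 1.
  by move=> tT; rewrite -exprMn tT expr1n.
have A0 : isogeny_factor (u ^+ q) (v ^+ q) = 0.
  move: uU vV; set w := u ^+ q; set z := v ^+ q => uw vz.
  transitivity (w ^+ 2 * z ^+ 2 * isogeny_factor_rec u v); last by rewrite B0 mulr0.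
  transitivity ((u * w) ^+ 2 * (v * z) ^+ 2 - w * (u * w) * (v * z) ^+ 2
    - z * (u * w) ^+ 2 * (v * z) - w ^+ 2 * z * (v * z) - w * z ^+ 2 * (u * w)).
    by rewrite uw vz /isogeny_factor; ring.
  by rewrite /isogeny_factor_rec; ring.
by have := isogeny_factors_coprime two0 A0; rewrite isogeny_factor_frob ?eqxx ?conj1.
Qed.

(** Such a root is shared with h*, and h - h* = u^2 (u^3 - 1) forces u^3 = 1. For m even, 3 divides
    q - 1, so u^q = u and u^2 = 1; hence u = 1, but h(1) = 1. *)
Lemma trinomial7_neq0 (u : F) : ~~ odd m -> u * u ^+ q = 1 -> trinomial7 u != 0.
Proof.
move=> m_even uU; apply/eqP=> h0.
have r0 : trinomial7_rec u = 0.
  by rewrite -trinomial7_frob // h0 expr0n; case: (q) q_gt1 => // n; rewrite mulr0.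
have u0 : u != 0 by apply/eqP=> u0; move/eqP: uU; rewrite u0 mul0r eq_sym oner_eq0.
have u3 : u ^+ 3 = 1.
  apply: (mulfI (expf_neq0 2 u0)); apply/eqP; rewrite -subr_eq0; apply/eqP.
  transitivity (trinomial7 u - trinomial7_rec u); last by rewrite h0 r0 subr0.
  by rewrite /trinomial7 /trinomial7_rec; ring.
have q3 : q = (q %/ 3 * 3 + 1)%N.
  rewrite {1}(divn_eq q 3); congr (_ + _)%N.
  rewrite q_def -(odd_double_half m) (negPf m_even) add0n -mul2n expnM -modnXm.
  by rewrite exp1n.
have uq : u ^+ q = u by rewrite q3 exprD mulnC exprM u3 expr1n mul1r.
have u2 : u ^+ 2 = 1 by rewrite expr2 -[X in _ * X]uq.
have u1 : u = 1 by move: u3; rewrite exprS u2 mulr1.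
have E : trinomial7 (1 : F) = 1 + 2%:R by rewrite /trinomial7; ring.
by move/eqP: h0; rewrite u1 E two0 addr0 oner_eq0.
Qed.

Lemma F3_injective : ~~ odd m -> m <> 0 %[mod 3] ->
  injective (fun x : F => (F3 F q).[x]).
Proof.
move=> m_even m_mod3 x y.
(* 2 has order 3 modulo 7. *)
have coprime7 : coprime 7 (q - 1).
  rewrite prime_coprime // -eqn_mod_dvd ?(ltnW q_gt1) //.
  rewrite q_def (divn_eq m 3) expnD [(_ * 3)%N]mulnC expnM -modnMml -modnXm exp1n.
  have := ltn_pmod m (isT : (0 < 3)%N).
  by case: (m %% 3)%N m_mod3 => [|[|[|]]].
have expqS (t : F) : t != 0 -> t ^+ (q - 1) * (t ^+ (q - 1)) ^+ q = 1.
  by move=> t0; rewrite -exprS -exprM -(addn1 q) expr_cardB1.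
have root_free (t : F) : t != 0 -> (F3 F q).[t] != 0.
  by move=> t0; rewrite horner_F3 mulf_neq0 ?expf_neq0 // trinomial7_neq0 ?expqS.
have F30 : (F3 F q).[0] = 0 by rewrite horner_F3 expr0n mul0r.
have [->|x0] := eqVneq x 0; have [->|y0] := eqVneq y 0 => //.
- by rewrite F30 => /esym/eqP; rewrite (negPf (root_free _ y0)).
- by rewrite F30 => /eqP; rewrite (negPf (root_free _ x0)).
rewrite !horner_F3.
have uU := expqS _ x0; have vV := expqS _ y0.
move: (trinomial7_neq0 m_even uU) (trinomial7_neq0 m_even vV) => hu hv E.
have frobE (t : F) : t != 0 ->
    (t ^+ 7 * trinomial7 (t ^+ (q - 1))) ^+ q =
    t ^+ 7 * trinomial7_rec (t ^+ (q - 1)).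
  move=> t0; rewrite -trinomial7_frob ?expqS // exprMn mulrA; congr (_ * _).
  by rewrite -!exprM -exprD; congr (_ ^+ _); lia.
have Eq := congr1 (fun t => t ^+ q) E; rewrite /= !frobE // in Eq.
have uv : x ^+ (q - 1) = y ^+ (q - 1).
  apply: trinomial7_ratio_inj => //.
  apply: (mulfI (mulf_neq0 (expf_neq0 7 x0) (expf_neq0 7 y0))).
  by rewrite mulrACA E -Eq mulrACA mulrC mulrACA; ring.
(* The order of x/y now divides both 7 and q - 1, which are coprime; Bezout gives x/y = 1. *)
move: E; rewrite uv => /(mulIf hv) xy7.
have xy0 : x / y != 0 by rewrite mulf_neq0 ?invr_eq0.
have r7 : (x / y) ^+ 7 = 1 by rewrite exprMn exprVn xy7 divff ?expf_neq0.
have rq : (x / y) ^+ (q - 1) = 1 by rewrite exprMn exprVn uv divff ?expf_neq0.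
suff r1 : x / y = 1 by rewrite -[x](divfK y0) r1 mul1r.
case: (egcdnP (q - 1) (isT : (0 < 7)%N)) => a b Eab _.
move: coprime7; rewrite /coprime => /eqP g1; rewrite g1 in Eab.
have := exprM (x / y) 7 a; rewrite mulnC Eab r7 expr1n.
by rewrite exprD mulnC exprM rq expr1n mul1r expr1.
Qed.

Lemma ex_prim_root_cardB1 : exists z : F, ((q - 1) * (q + 1)).-primitive_root z.
Proof.
set n := ((q - 1) * (q + 1))%N.
have n_gt0 : (0 < n)%N by rewrite /n; nia.
have : has n.-primitive_root (enum (predC1 (0 : F))).
  apply: has_prim_root => //; last 2 first.
  - exact: enum_uniq.
  - by rewrite -cardE cardC1 cardF /n; nia.
  apply/allP=> x; rewrite mem_enum inE => x0.
  by rewrite unity_rootE expr_cardB1.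
by case/hasP=> z _; exists z.
Qed.

(** Each case has an explicit collision. For m odd, 3 divides q + 1, so a primitive cube root of
    unity, a root of h, is a (q-1)-st power and a nonzero element maps to 0. For 3 dividing m, 7
    divides q - 1, so a primitive 7th root of unity has the same image as 1. *)
Lemma F3_not_injective : odd m \/ m = 0 %[mod 3] ->
  ~ injective (fun x : F => (F3 F q).[x]).
Proof.
move=> m_cases inj; have [z z_prim] := ex_prim_root_cardB1.
have zq1 := prim_expr_order z_prim.
have z0 : z != 0.
  apply/eqP=> z0; move/eqP: zq1.
  by rewrite z0 expr0n (gtn_eqF (prim_order_gt0 z_prim)) eq_sym oner_eq0.
case: m_cases => [m_odd|m_mod3].
- have d3 : (3 %| q + 1)%N.
    rewrite q_def -(odd_double_half m) m_odd -mul2n expnD expnM.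
    by rewrite /dvdn -modnDml -modnMmr -modnXm exp1n.
  set w := z ^+ ((q + 1) %/ 3 * (q - 1)).
  have w3 : w ^+ 3 = 1.
    by rewrite -exprM mulnAC divnK // mulnC zq1.
  have w1 : w != 1.
    (* The exponent of z lies strictly between 0 and its order. *)
    rewrite -(prim_order_dvd z_prim); apply/negP=> /dvdn_leq; nia.
  have h0 : trinomial7 w = 0.
    have w10 : w - 1 != 0 by rewrite subr_eq0.
    apply: (mulfI w10); rewrite mulr0.
    have -> : (w - 1) * trinomial7 w =
        (w ^+ 3 - 1) * (w ^+ 5 - w ^+ 4 + w ^+ 3 - w + 1).
      by rewrite /trinomial7; ring.
    by rewrite w3 subrr mul0r.
  have /eqP : z ^+ ((q + 1) %/ 3) = 0.
    apply: inj; rewrite !horner_F3 -[in trinomial7 _]exprM -/w h0 mulr0.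
    by rewrite expr0n mul0r.
  by apply/negP/expf_neq0.
have d7 : (7 %| q - 1)%N.
  rewrite -eqn_mod_dvd ?(ltnW q_gt1) // q_def (divn_eq m 3) m_mod3 addn0 mulnC.
  by rewrite expnM -modnXm exp1n.
set w := z ^+ ((q - 1) %/ 7 * (q + 1)).
have w7 : w ^+ 7 = 1 by rewrite -exprM mulnAC divnK // zq1.
have w1 : w != 1.
  rewrite -(prim_order_dvd z_prim); apply/negP=> /dvdn_leq; nia.
move/eqP: w1; apply; apply: inj.
by rewrite !horner_F3 (expr_dvd w7 d7) w7 !expr1n.
Qed.

End QuadraticExtension.

Theorem theorem3p4 (m q : nat) (m_gt0 : (0 < m)%N) (q_def : q = (2 ^ m)%N)
    (F : finFieldType) (cardF : #|F| = (q ^ 2)%N) :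
  permutation_poly (F3 F q) <-> (~~ odd m /\ m <> 0 %[mod 3]).
Proof.
split=> [/bij_inj inj | [m_even m_mod3]]; last first.
  by apply: injF_bij; apply: (F3_injective m_gt0 q_def cardF).
by split; [apply/negP=> m_odd | move=> m_mod3];
  apply: (F3_not_injective m_gt0 q_def cardF) inj; [left | right].
Qed.
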